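(* Let $n\geq2$. There is no strictly monotone function $\Psi\colon[0,\infty)\to\mathbb{R}$ such that the mapping $$F\mapsto W(F)=\Psi(\|\log U\|^2)=\Psi(\|\log V\|^2),\qquad U=\sqrt{F^TF},\quad V=\sqrt{FF^T},$$ is rank-one convex on $\mathrm{GL}^+(n)$.
   Context: $\mathrm{GL}^+(n)$ is the group of real $n\times n$ matrices with positive determinant. For $F\in\mathrm{GL}^+(n)$, $U=\sqrt{F^TF}$ and $V=\sqrt{FF^T}$ are positive definite symmetric square roots, $\log$ is the principal matrix logarithm, and $\|X\|^2=\mathrm{tr}(XX^T)$ is the squared Frobenius norm. (The two expressions for $W$ coincide since $U$ and $V$ have the same eigenvalues.) For $\xi,\eta\in\mathbb{R}^n$, $(\xi\otimes\eta)_{ij}=\xi_i\eta_j$. A function $W\colon\mathrm{GL}^+(n)\to\mathbb{R}$ is called rank-one convex if for all $F\in\mathrm{GL}^+(n)$, all $\xi,\eta\in\mathbb{R}^n$ and any interval $I\subset\mathbb{R}$ such that $\det(F+t\,\xi\otimes\eta)>0$ for all $t\in I$, the mapping $I\to\mathbb{R}$, $t\mapsto W(F+t\,\xi\otimes\eta)$ is convex. *)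

(* Defs.v *)
From HB Require Import structures.
From mathcomp Require Import all_boot all_order all_algebra.
From mathcomp Require Import all_classical all_reals all_analysis.
From mathcomp.real_closed Require Import complex.

Set Implicit Arguments.
Unset Strict Implicit.
Unset Printing Implicit Defensive.

Import Order.TTheory GRing.Theory Num.Theory.
Import numFieldNormedType.Exports.

Local Open Scope classical_set_scope.
Local Open Scope ring_scope.

Definition GLpos (R : realType) (n : nat) : set 'M[R]_n :=
  [set F | 0 < \det F].

Definition posdefmx (R : realType) (n : nat) (A : 'M[R]_n) : Prop :=
  A^T = A /\ forall x : 'cV[R]_n, x != 0 -> 0 < \tr (x^T *m A *m x).

(* [xget 0] selects the element of a set that is unique here whenever [A] is
   positive definite; the default 0 is only reached for other [A]. *)
Definition sqrtmx (R : realType) (n : nat) (A : 'M[R]_n) : 'M[R]_n :=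
  xget 0 [set U | posdefmx U /\ U *m U = A].

Definition expmx (R : realType) (n : nat) (X : 'M[R]_n) : 'M[R]_n :=
  limn (series (fun k : nat => (k`!%:R)^-1 *: X ^+ k)).

(* The principal logarithm of [A] is the unique solution of exp X = A all of
   whose complex eigenvalues lie in the strip |Im z| < pi; it exists, and is
   real, when the real matrix [A] has no eigenvalue in ]-oo, 0]. *)
Definition principal_log (R : realType) (n : nat) (A X : 'M[R]_n) : Prop :=
  expmx X = A /\
  forall z : R[i], eigenvalue (map_mx (real_complex R) X) z ->
    `|complex.Im z| < pi.

Definition logmx (R : realType) (n : nat) (A : 'M[R]_n) : 'M[R]_n :=
  xget 0 [set X | principal_log A X].

Definition frobenius2 (R : realType) (n : nat) (X : 'M[R]_n) : R :=
  \tr (X *m X^T).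

Definition tensor (R : realType) (n : nat) (xi eta : 'cV[R]_n) : 'M[R]_n :=
  \matrix_(i, j) (xi i 0 * eta j 0).

(* [W] stands for a function on [GLpos]: its values elsewhere are not used. *)
Definition rank_one_convex (R : realType) (n : nat) (W : 'M[R]_n -> R) : Prop :=
  forall (F : 'M[R]_n) (xi eta : 'cV[R]_n) (I : set R),
    GLpos F -> is_interval I ->
    (forall t, I t -> 0 < \det (F + t *: tensor xi eta)) ->
    convex_function (I : set R^o) (fun t : R^o => W (F + t *: tensor xi eta)).

Definition strictly_monotone_nneg (R : realType) (Psi : R -> R) : Prop :=
  {in `[0, +oo[ &, {homo Psi : x y / x < y}} \/
  {in `[0, +oo[ &, {homo Psi : x y /~ x < y}}.

Definition stretchU (R : realType) (n : nat) (F : 'M[R]_n) : 'M[R]_n :=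
  sqrtmx (F^T *m F).

Definition stretchV (R : realType) (n : nat) (F : 'M[R]_n) : 'M[R]_n :=
  sqrtmx (F *m F^T).

(* Main.v *)
Require Import Defs.
From HB Require Import structures.
From mathcomp Require Import all_boot all_order all_algebra.
From mathcomp Require Import all_classical all_reals all_analysis.
From mathcomp.real_closed Require Import complex.
From mathcomp Require Import ring lra.

(** The value of W at F only depends on the eigenvalues d_i > 0 of F^T F: the
    matrix log U is symmetric with eigenvalues (ln d_i) / 2, so that
    W(F) = Psi (sum_i (ln d_i)^2 / 4). Since F F^T is orthogonally similar to
    F^T F, the same number comes from V.

    With square roots and logarithms given as the solution of an equation, this
    reduction rests on two uniqueness facts. Write A = Q^T diag(d) Q with Q
    orthogonal (lemma sym_orthodiagonalizable). A positive definite square root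
    of A must multiply the i-th row of Q by sqrt d_i (lemma sqrtmx_orthodiag).
    A logarithm X of A with spectrum in |Im z| < pi has real spectrum, because
    e^z is an eigenvalue of a symmetric matrix for each eigenvalue z of X (lemma
    principal_log_real); and X has no Jordan block, because a Jordan block of X
    would give one of exp X = A (lemma eigenvector_log). So X multiplies the i-th
    row of Q by ln d_i (lemma logmx_orthodiag).

    A convex function on an interval does not exceed, at an interior point, the
    larger of its two end values. For a strictly increasing Psi this property
    passes to h = sum_i (ln d_i)^2 / 4 itself, and for a strictly decreasing Psi
    to -h. It is tested on the rank-one line
      F(t) = l [[1 + t, c t], [0, 1]]
    in a coordinate plane, extended by the identity.

    - Psi decreasing (lemma decreasing_not_rank_one_convex): for l = 1 and c = 0,
      h vanishes at t = 0 and is positive elsewhere.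

    - Psi increasing (lemma increasing_not_rank_one_convex): put L = 2 ln l,
      m = ln (1 + t) and let e^theta be the ratio of the two singular values.
      Then h = ((L + m)^2 + theta^2) / 2, where sinh (theta/2) = K sinh (m/2) and
      K^2 = 1 + c^2. For large K and moderate m > 0, theta is about
      2 ln (2 K sinh (m/2)): large, with a negative second derivative that does
      not depend on K. So theta theta'' outweighs the bounded terms in the second
      derivative of (m^2 + theta^2) / 2, and a suitable linear term L m turns
      this concavity into an interior maximum. In units of ln 2, the choice of
      K with theta = 12 at m = 2, and of L = -34, gives h = 578 at m = 0,
      h = 584 at m = 2, and h <= 578 at m = 4, since theta <= 16 there. *)

Set Implicit Arguments.
Unset Strict Implicit.
Unset Printing Implicit Defensive.

Import Order.TTheory GRing.Theory Num.Theory.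
Import numFieldNormedType.Exports.

Local Open Scope classical_set_scope.
Local Open Scope ring_scope.

(** * The matrix exponential *)

(** The sum of the absolute values of all entries is a submultiplicative norm
    that dominates every entry. *)
Lemma exprmx_entry_le (R : realType) (n : nat) (X : 'M[R]_n) (k : nat)
    (i j : 'I_n) :
  `|(X ^+ k) i j| <= (\sum_a \sum_b `|X a b|) ^+ k.
Proof.
elim: k i => [|k IH] i.
  by rewrite !expr0 mxE; case: eqP => _; rewrite ?normr0 ?normr1.
rewrite exprS mxE; apply: le_trans (ler_norm_sum _ _ _) _.
apply: (@le_trans _ _ (\sum_l `|X i l| * (\sum_a \sum_b `|X a b|) ^+ k)).
  by apply: ler_sum => l _; rewrite normrM ler_wpM2l.
rewrite -mulr_suml exprS ler_wpM2r ?exprn_ge0 ?sumr_ge0// => [a _|].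
  exact: sumr_ge0.
rewrite [leRHS](bigD1 i)//= lerDl sumr_ge0// => a _.
exact: sumr_ge0.
Qed.

Lemma is_cvg_series_expmx_entry (R : realType) (n : nat) (X : 'M[R]_n)
    (i j : 'I_n) :
  cvgn (series (fun k => k`!%:R^-1 * (X ^+ k) i j)).
Proof.
apply: normed_cvg.
pose M := \sum_a \sum_b `|X a b|.
apply: (@series_le_cvg _ _ (exp_coeff M)) => [k|k|k|].
- exact: normr_ge0.
- rewrite /exp_coeff /= divr_ge0 ?exprn_ge0// sumr_ge0// => a _.
  exact: sumr_ge0.
- rewrite /exp_coeff /= normrM ger0_norm ?invr_ge0// mulrC ler_wpM2r ?invr_ge0//.
  exact: exprmx_entry_le.
- exact: is_cvg_series_exp_coeff.
Qed.

(** The series converges entrywise, which is convergence of matrices as there are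
    finitely many entries. *)
Lemma cvg_expmx (R : realType) (n : nat) (X : 'M[R]_n) :
  series (fun k : nat => k`!%:R^-1 *: X ^+ k) @ \oo --> expmx X.
Proof.
pose L := \matrix_(i, j) limn (series (fun k => k`!%:R^-1 * (X ^+ k) i j)).
suff cL : series (fun k : nat => k`!%:R^-1 *: X ^+ k) @ \oo --> L.
  by apply/cvg_ex; exists L.
move=> B [P nP sPB]; apply: (filterS sPB).
have nP' i j : \forall N \near \oo,
    P i j (series (fun k : nat => k`!%:R^-1 *: X ^+ k) N i j).
  have nPij : \forall N \near \oo,
      P i j (series (fun k => k`!%:R^-1 * (X ^+ k) i j) N).
    by apply: (@is_cvg_series_expmx_entry R n X i j); have := nP i j; rewrite mxE.
  apply: filterS nPij => N; rewrite /series /= summxE.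
  by under [X in _ -> P i j X]eq_bigr do rewrite mxE.
pose S := series (fun k : nat => k`!%:R^-1 *: X ^+ k).
have nP2 i : \forall N \near \oo, forall j, P i j (S N i j).
  exact: (@filter_forall nat _ (fun j N => P i j (S N i j)) \oo _ (nP' i)).
exact: (@filter_forall nat _ (fun i N => forall j, P i j (S N i j)) \oo _ nP2).
Qed.

(** Matrix identities for the exponential are checked through these real-valued
    pairings, whose series can be compared termwise. *)
Lemma cvg_expmx_pairing (R : realType) (n : nat) (X : 'M[R]_n) (u : 'rV[R]_n)
    (w : 'cV[R]_n) :
  series (fun k : nat => k`!%:R^-1 * (u *m X ^+ k *m w) 0 0) @ \oo -->
  (u *m expmx X *m w) 0 0.
Proof.
pose phi (M : 'M[R]_n) : R := (u *m M *m w) 0 0.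
have phiE M : phi M = \sum_j (\sum_i u 0 i * M i j) * w j 0.
  by rewrite /phi !mxE; apply: eq_bigr => j _; rewrite !mxE.
have cphi : continuous phi.
  rewrite (_ : phi = fun M => \sum_j (\sum_i u 0 i * M i j) * w j 0); last first.
    by apply/funext => M; rewrite phiE.
  have cij i j : continuous (fun M : 'M[R]_n => u 0 i * M i j).
    move=> M; apply: (@cvgMl_tmp _ _ (nbhs M)); exact: coord_continuous.
  have cj j : continuous (fun M : 'M[R]_n => \sum_i u 0 i * M i j).
    apply: (@continuous_big R _ +%R 0); first exact: add_continuous.
    by move=> i _; exact: cij.
  apply: (@continuous_big R _ +%R 0); first exact: add_continuous.
  by move=> j _ M; apply: (@cvgMr_tmp _ _ (nbhs M)); exact: cj.
rewrite -/(phi _).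
rewrite (_ : series _ = phi \o series (fun k : nat => k`!%:R^-1 *: X ^+ k)).
  exact: cvg_comp (@cvg_expmx R n X) (cphi _).
apply/funext => N /=; rewrite /series /= /phi mulmx_sumr mulmx_suml summxE.
by apply: eq_bigr => k _; rewrite -scalemxAr -scalemxAl [RHS]mxE.
Qed.

Lemma cvg_series_expR (R : realType) (y : R) :
  series (fun k : nat => k`!%:R^-1 * y ^+ k) @ \oo --> expR y.
Proof.
rewrite (_ : (fun k : nat => _) = exp_coeff y); last first.
  by apply/funext => k; rewrite /exp_coeff /= mulrC.
exact: is_cvg_series_exp_coeff.
Qed.

Lemma cvg_series_expR_deriv (R : realType) (y : R) :
  series (fun k : nat => k`!%:R^-1 * (k%:R * y ^+ k.-1)) @ \oo --> expR y.
Proof.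
have -> : (fun k : nat => k`!%:R^-1 * (k%:R * y ^+ k.-1)) =
    fun k => k%:R * k`!%:R^-1 * y ^+ k.-1.
  by apply/funext => k; rewrite mulrCA mulrA.
have -> : expR y = limn (pseries (pseries_diffs (fun k => k`!%:R^-1)) y).
  by rewrite pseries_diffs_inv_fact expRE.
apply: (@pseries_diffs_equiv R (fun k => k`!%:R^-1) y).
rewrite pseries_diffs_inv_fact /pseries -exp_coeffE.
exact: is_cvg_series_exp_coeff.
Qed.

Lemma rowP_pairing (R : realType) (n : nat) (u v : 'rV[R]_n) :
  (forall w : 'cV[R]_n, (u *m w) 0 0 = (v *m w) 0 0) -> u = v.
Proof.
move=> uv; apply/rowP => j; have := uv (delta_mx j 0).
by rewrite -!colE !mxE.
Qed.

Lemma cvgn_unique (R : realType) (s : R^nat) (a b : R) :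
  s @ \oo --> a -> s @ \oo --> b -> a = b.
Proof. exact: (@cvg_unique R (@Rhausdorff R) (s @ \oo) _ a b). Qed.

Lemma cvg_series_lin2 (R : realType) (s t : R^nat) (a b x y : R) :
  series s @ \oo --> a -> series t @ \oo --> b ->
  series (fun k => s k * x + t k * y) @ \oo --> a * x + b * y.
Proof.
move=> sa tb.
have -> : series (fun k => s k * x + t k * y) =
    (fun N => series s N * x + series t N * y).
  by apply/funext => N; rewrite /series /= !mulr_suml -big_split.
by apply: cvgD; apply: cvgM => //; exact: cvg_cst.
Qed.

(** The exponential is a limit of polynomials in [X], hence commutes with it. *)
Lemma expmx_comm (R : realType) (n : nat) (X : 'M[R]_n) :
  X *m expmx X = expmx X *m X.
Proof.
apply/row_matrixP => i; apply: rowP_pairing => w.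
rewrite !rowE; set u : 'rV[R]_n := delta_mx 0 i.
rewrite mulmxA [in RHS]mulmxA -[in RHS]mulmxA.
have c1 := @cvg_expmx_pairing R n X (u *m X) w.
have c2 := @cvg_expmx_pairing R n X u (X *m w).
have XE : (fun k : nat => k`!%:R^-1 * (u *m X *m X ^+ k *m w) 0 0) =
    (fun k : nat => k`!%:R^-1 * (u *m X ^+ k *m (X *m w)) 0 0).
  apply/funext => k; congr (_ * _); congr (fun_of_matrix _ 0 0).
  rewrite !mulmxA; congr (_ *m _); rewrite -!mulmxA; congr (_ *m _).
  by rewrite !mulmxE -exprS exprSr.
by rewrite XE in c1; exact: cvgn_unique c1 c2.
Qed.

(** On a Jordan block of size two, exp (y + N) = e^y (1 + N); the case v = 0 is
    that of an eigenvector. *)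
Lemma expmx_jordan2 (R : realType) (n : nat) (X : 'M[R]_n) (y : R)
    (u v : 'rV[R]_n) :
  u *m X = y *: u + v -> v *m X = y *: v ->
  u *m expmx X = expR y *: (u + v).
Proof.
move=> uX vX.
have vXk k : v *m X ^+ k = y ^+ k *: v.
  elim: k => [|k IH]; first by rewrite !expr0 mulmx1 scale1r.
  by rewrite exprSr -mulmxE mulmxA IH -scalemxAl vX scalerA -exprSr.
have uXk k : u *m X ^+ k = y ^+ k *: u + (k%:R * y ^+ k.-1) *: v.
  elim: k => [|k IH]; first by rewrite !expr0 mulmx1 scale1r mul0r scale0r addr0.
  rewrite exprS -mulmxE mulmxA uX mulmxDl -scalemxAl IH vXk scalerDr !scalerA.
  rewrite -exprS -addrA -scalerDl; congr (_ + _ *: _) => /=.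
  case: k {IH} => [|k]; first by rewrite !mul0r mulr0 expr0 mul1r add0r.
  by rewrite mulrCA -exprS -[X in _ = X * _]natr1 mulrDl mul1r.
apply: rowP_pairing => w.
have c1 := @cvg_expmx_pairing R n X u w.
apply: (cvgn_unique c1).
rewrite -scalemxAl mulmxDl mxE [X in _ * X]mxE mulrDr.
have c2 := cvg_series_lin2 (x := (u *m w) 0 0) (y := (v *m w) 0 0)
  (@cvg_series_expR R y) (@cvg_series_expR_deriv R y).
have XE : (fun k : nat => k`!%:R^-1 * (u *m X ^+ k *m w) 0 0) =
    (fun k : nat => k`!%:R^-1 * y ^+ k * (u *m w) 0 0 +
                    k`!%:R^-1 * (k%:R * y ^+ k.-1) * (v *m w) 0 0).
  apply/funext => k; rewrite uXk mulmxDl -!scalemxAl mxE mulrDr.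
  by congr (_ + _); rewrite mxE mulrA.
by rewrite XE; exact: c2.
Qed.

(** * Exponentials of complex numbers and of complex eigenvectors *)

Definition egf (R : realType) (s : nat -> R) (t : R) : R :=
  limn (pseries (fun k => k`!%:R^-1 * s k) t).

Lemma is_cvg_egf (R : realType) (s : nat -> R) (C M t : R) :
  0 <= C -> 0 <= M -> (forall k, `|s k| <= C * M ^+ k) ->
  cvgn (pseries (fun k => k`!%:R^-1 * s k) t).
Proof.
move=> C0 M0 sM; rewrite /pseries; apply: normed_cvg.
apply: (@series_le_cvg _ _ (C *: exp_coeff (M * `|t|))) => [k|k|k|].
- exact: normr_ge0.
- rewrite /exp_coeff /GRing.scale /=.
  by rewrite mulr_ge0// divr_ge0 ?exprn_ge0// mulr_ge0.
- have -> : (C *: exp_coeff (M * `|t|)) k =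
      k`!%:R^-1 * (C * M ^+ k) * `|t| ^+ k.
    by rewrite (_ : _ k = C * ((M * `|t|) ^+ k / k`!%:R))// exprMn; ring.
  rewrite /= !normrM normrX ger0_norm ?invr_ge0//.
  by rewrite ler_wpM2r ?exprn_ge0// ler_wpM2l ?invr_ge0.
- by apply: is_cvg_seriesZ; exact: is_cvg_series_exp_coeff.
Qed.

(** Differentiating an exponential generating function shifts its sequence. *)
Lemma is_derive_egf (R : realType) (s : nat -> R) (C M t : R) :
  0 <= C -> 0 <= M -> (forall k, `|s k| <= C * M ^+ k) ->
  is_derive t (1 : R) (egf s) (egf (fun k => s k.+1) t).
Proof.
move=> C0 M0 sM.
have dE (u : nat -> R) : pseries_diffs (fun k => k`!%:R^-1 * u k) =
    (fun k => k`!%:R^-1 * u k.+1).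
  by apply/funext => k; rewrite /pseries_diffs factS natrM invfM mulrA mulVKf.
have bS (u : nat -> R) (D : R) : (forall k, `|u k| <= D * M ^+ k) ->
    forall k, `|u k.+1| <= (D * M) * M ^+ k.
  by move=> uM k; rewrite -mulrA -exprS.
rewrite /egf -dE.
have tK : `|t| < `| `|t| + 1| by rewrite [ltRHS]ger0_norm ?addr_ge0// ltrDl.
apply: pseries_snd_diffs tK.
- exact: is_cvg_egf sM.
- by rewrite dE; apply: is_cvg_egf (bS _ _ sM) => //; rewrite mulr_ge0.
- rewrite !dE; apply: is_cvg_egf (bS _ _ (bS _ _ sM)) => //.
  by rewrite !mulr_ge0.
Qed.

(** The real and imaginary parts c k and d k of (a + ib)^k have generating
    functions that solve the system f' = a f - b g, g' = b f + a g. Rotating (f, g)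
    by the angle - bt and scaling by e^(- at) makes them constant, hence
    f = e^(at) cos bt and g = e^(at) sin bt; the claim is the value at t = 1. *)
Lemma cvg_series_expC (R : realType) (a b : R) (c d : nat -> R) :
  c 0%N = 1 -> d 0%N = 0 ->
  (forall k, c k.+1 = a * c k - b * d k) ->
  (forall k, d k.+1 = b * c k + a * d k) ->
  series (fun k : nat => k`!%:R^-1 * c k) @ \oo --> expR a * cos b /\
  series (fun k : nat => k`!%:R^-1 * d k) @ \oo --> expR a * sin b.
Proof.
move=> c0 d0 cS dS; pose M := `|a| + `|b|.
have M0 : 0 <= M by rewrite addr_ge0.
have cdM k : `|c k| + `|d k| <= M ^+ k.
  elim: k => [|k IH]; first by rewrite c0 d0 normr1 normr0 addr0 expr0.
  rewrite cS dS exprS; apply: le_trans (ler_wpM2l M0 IH).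
  apply: le_trans (lerD (ler_normB _ _) (ler_normD _ _)) _.
  rewrite !normrM /M; lra.
have cM k : `|c k| <= 1 * M ^+ k.
  by rewrite mul1r (le_trans _ (cdM k))// lerDl.
have dM k : `|d k| <= 1 * M ^+ k.
  by rewrite mul1r (le_trans _ (cdM k))// lerDr.
have cvc t : cvgn (pseries (fun k => k`!%:R^-1 * c k) t).
  exact: is_cvg_egf ler01 M0 cM.
have cvd t : cvgn (pseries (fun k => k`!%:R^-1 * d k) t).
  exact: is_cvg_egf ler01 M0 dM.
have linE x y t :
    egf (fun k => x * c k + y * d k) t = x * egf c t + y * egf d t.
  rewrite mulrC [y * _]mulrC; rewrite /egf /pseries; apply: cvg_lim => //.
  have -> : (fun k => k`!%:R^-1 * (x * c k + y * d k) * t ^+ k) =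
      (fun k => k`!%:R^-1 * c k * t ^+ k * x + k`!%:R^-1 * d k * t ^+ k * y).
    by apply/funext => k; ring.
  exact: cvg_series_lin2 (cvc t) (cvd t).
have Dc t : is_derive t (1 : R) (egf c) (a * egf c t - b * egf d t).
  have := is_derive_egf t ler01 M0 cM.
  rewrite -[- (b * _)]mulNr -linE; congr (is_derive _ _ _ (egf _ _)).
  by apply/funext => k; rewrite cS mulNr.
have Dd t : is_derive t (1 : R) (egf d) (b * egf c t + a * egf d t).
  have := is_derive_egf t ler01 M0 dM.
  rewrite -linE; congr (is_derive _ _ _ (egf _ _)).
  by apply/funext => k; rewrite dS.
pose p t := expR (- (a * t)) * (egf c t * cos (b * t) + egf d t * sin (b * t)).
pose q t := expR (- (a * t)) * (egf d t * cos (b * t) - egf c t * sin (b * t)).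
have egf0 (u : nat -> R) : egf u 0 = u 0%N.
  apply: lim_near_cst => //; near=> m.
  rewrite /pseries /series /= -[m]prednK; last by near: m; exact: nbhs_infty_gt.
  rewrite big_nat_recl//= expr0 mulr1 invr1 mul1r big1 ?addr0// => k _.
  by rewrite exprS mul0r mulr0.
have p1 : p 1 = p 0.
  apply: is_derive_0_is_cst => t; rewrite /p.
  by apply: trigger_derive; rewrite /GRing.scale /=; ring.
have q1 : q 1 = q 0.
  apply: is_derive_0_is_cst => t; rewrite /q.
  by apply: trigger_derive; rewrite /GRing.scale /=; ring.
have p0 : p 0 = 1.
  by rewrite /p !mulr0 oppr0 expR0 cos0 sin0 !egf0 c0 d0; ring.
have q0 : q 0 = 0.
  by rewrite /q !mulr0 oppr0 expR0 cos0 sin0 !egf0 c0 d0; ring.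
move: p1 q1; rewrite p0 q0 /p /q !mulr1 => p1 q1.
have cs := cos2Dsin2 b; have e1 := expRxMexpNx_1 a.
have cE : egf c 1 = expR a * cos b.
  transitivity (expR a * (expR (- a) * (egf c 1 * cos b + egf d 1 * sin b)) * cos b
    - expR a * (expR (- a) * (egf d 1 * cos b - egf c 1 * sin b)) * sin b).
    rewrite !mulrA e1 !mul1r.
    transitivity (egf c 1 * (cos b ^+ 2 + sin b ^+ 2)); last by ring.
    by rewrite cs mulr1.
  by rewrite p1 q1; ring.
have dE : egf d 1 = expR a * sin b.
  transitivity (expR a * (expR (- a) * (egf c 1 * cos b + egf d 1 * sin b)) * sin b
    + expR a * (expR (- a) * (egf d 1 * cos b - egf c 1 * sin b)) * cos b).
    rewrite !mulrA e1 !mul1r.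
    transitivity (egf d 1 * (cos b ^+ 2 + sin b ^+ 2)); last by ring.
    by rewrite cs mulr1.
  by rewrite p1 q1; ring.
have at1 (u : nat -> R) : pseries (fun k => k`!%:R^-1 * u k) 1 =
    series (fun k => k`!%:R^-1 * u k).
  by rewrite /pseries; congr series; apply/funext => k /=; rewrite expr1n mulr1.
rewrite -cE -dE; split; rewrite -at1; [exact: cvc|exact: cvd].
Unshelve. all: by end_near. Qed.

(** In terms of v = p + iq and z = a + ib, the rule that v X = z v implies
    v (exp X) = e^z v. *)
Lemma expmx_eigenC (R : realType) (n : nat) (X : 'M[R]_n) (a b : R)
    (p q : 'rV[R]_n) :
  p *m X = a *: p - b *: q -> q *m X = b *: p + a *: q ->
  p *m expmx X = expR a *: (cos b *: p - sin b *: q) /\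
  q *m expmx X = expR a *: (sin b *: p + cos b *: q).
Proof.
move=> pX qX.
pose cd k := iter k (fun z => (a * z.1 - b * z.2, b * z.1 + a * z.2)) (1, 0 : R).
have [cvc cvd] := @cvg_series_expC R a b (fun k => (cd k).1) (fun k => (cd k).2)
  erefl erefl (fun=> erefl) (fun=> erefl).
have XkE k : p *m X ^+ k = (cd k).1 *: p + (cd k).2 *: (- q) /\
             q *m X ^+ k = (cd k).2 *: p + (cd k).1 *: q.
  elim: k => [|k [IHp IHq]].
    by rewrite expr0 !mulmx1 !scale1r !scale0r addr0 add0r.
  rewrite exprSr -!mulmxE !mulmxA IHp IHq !mulmxDl -!scalemxAl mulNmx pX qX /=.
  by split; apply/rowP => j; rewrite !mxE; ring.
have lin (w : 'cV[R]_n) x y (u v : 'rV[R]_n) :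
    ((x *: u + y *: v) *m w) 0 0 = x * (u *m w) 0 0 + y * (v *m w) 0 0.
  by rewrite mulmxDl -!scalemxAl !mxE.
split; apply: rowP_pairing => w; have := @cvg_expmx_pairing R n X _ w.
- move=> /(_ p) c1; apply: (cvgn_unique c1).
  have -> : expR a *: (cos b *: p - sin b *: q) =
      (expR a * cos b) *: p + (expR a * sin b) *: (- q).
    by apply/rowP => j; rewrite !mxE; ring.
  have XE : (fun k : nat => k`!%:R^-1 * (p *m X ^+ k *m w) 0 0) =
      (fun k : nat => k`!%:R^-1 * (cd k).1 * (p *m w) 0 0 +
                      k`!%:R^-1 * (cd k).2 * (- q *m w) 0 0).
    by apply/funext => k; have [-> _] := XkE k; rewrite lin; ring.
  by rewrite XE lin; exact: cvg_series_lin2.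
- move=> /(_ q) c1; apply: (cvgn_unique c1).
  have -> : expR a *: (sin b *: p + cos b *: q) =
      (expR a * sin b) *: p + (expR a * cos b) *: q.
    by apply/rowP => j; rewrite !mxE; ring.
  have XE : (fun k : nat => k`!%:R^-1 * (q *m X ^+ k *m w) 0 0) =
      (fun k : nat => k`!%:R^-1 * (cd k).2 * (p *m w) 0 0 +
                      k`!%:R^-1 * (cd k).1 * (q *m w) 0 0).
    by apply/funext => k; have [_ ->] := XkE k; rewrite lin; ring.
  by rewrite XE lin; exact: cvg_series_lin2.
Qed.

(** * Real spectrum and eigenvectors of logarithms *)

(** As X is real, multiplication by X commutes with taking real and imaginary
    parts p and q of an eigenvector. *)
Lemma eigenvalue_complex_row (R : realType) (n : nat) (X : 'M[R]_n) (z : R[i]) :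
  eigenvalue (map_mx (real_complex R) X) z ->
  exists p q : 'rV[R]_n, [/\ (p != 0) || (q != 0),
    p *m X = complex.Re z *: p - complex.Im z *: q &
    q *m X = complex.Im z *: p + complex.Re z *: q].
Proof.
move=> /eigenvalueP [v vX v0].
exists (map_mx (@complex.Re R) v), (map_mx (@complex.Im R) v).
have ReX x (y : R) : complex.Re (x * real_complex R y) = complex.Re x * y.
  by case: x => a b /=; rewrite mulr0 subr0.
have ImX x (y : R) : complex.Im (x * real_complex R y) = complex.Im x * y.
  by case: x => a b /=; rewrite mulr0 add0r.
split.
- apply: contraNT v0; rewrite negb_or !negbK => /andP[/eqP p0 /eqP q0].
  apply/eqP/rowP => j; move/rowP: p0 => /(_ j); move/rowP: q0 => /(_ j).
  by rewrite !mxE; case: (v 0 j) => a b /= -> ->.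
- apply/rowP => j; move/rowP: vX => /(_ j) /(congr1 (@complex.Re R)).
  rewrite !mxE raddf_sum /=; under eq_bigr do rewrite mxE ReX.
  under [in X in _ -> X]eq_bigr do rewrite mxE.
  by move=> ->; case: (v 0 j) => x y; case: z => x' y'.
- apply/rowP => j; move/rowP: vX => /(_ j) /(congr1 (@complex.Im R)).
  rewrite !mxE raddf_sum /=; under eq_bigr do rewrite mxE ImX.
  under [in X in _ -> X]eq_bigr do rewrite mxE.
  by move=> ->; case: (v 0 j) => x y; case: z => x' y' /=; ring.
Qed.

Lemma row_dot_self_ge0 (R : realType) (n : nat) (p : 'rV[R]_n) :
  0 <= (p *m p^T) 0 0.
Proof. by rewrite mxE sumr_ge0// => j _; rewrite mxE -expr2 sqr_ge0. Qed.

Lemma row_dot_self_eq0 (R : realType) (n : nat) (p : 'rV[R]_n) :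
  (p *m p^T) 0 0 = 0 -> p = 0.
Proof.
rewrite mxE => /eqP; rewrite psumr_eq0 => [/allP p0|j _]; last first.
  by rewrite mxE -expr2 sqr_ge0.
apply/rowP => j; have := p0 j (mem_index_enum _).
by rewrite !mxE mulf_eq0 orbb => /eqP.
Qed.

(** Symmetric matrices have no rotation part: comparing pU . q with p . qU
    leaves y (|p|^2 + |q|^2) = 0. *)
Lemma sym_rotation_eq0 (R : realType) (n : nat) (U : 'M[R]_n) (x y : R)
    (p q : 'rV[R]_n) :
  U^T = U -> (p != 0) || (q != 0) ->
  p *m U = x *: p - y *: q -> q *m U = y *: p + x *: q -> y = 0.
Proof.
move=> Us pq0 pU qU.
have : (p *m U *m q^T) 0 0 = (q *m U *m p^T) 0 0.
  rewrite -[in RHS](trmxK (q *m U *m p^T)) [in RHS]mxE.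
  congr (fun_of_matrix _ 0 0).
  by rewrite !trmx_mul trmxK Us mulmxA.
have qp : (q *m p^T) 0 0 = (p *m q^T) 0 0.
  by rewrite -[in RHS](trmxK (p *m q^T)) [in RHS]mxE trmx_mul trmxK.
have lin (w : 'cV[R]_n) c d (u v : 'rV[R]_n) :
    ((c *: u + d *: v) *m w) 0 0 = c * (u *m w) 0 0 + d * (v *m w) 0 0.
  by rewrite mulmxDl -!scalemxAl !mxE.
rewrite pU qU -scaleNr !lin qp => E.
have {E} : y * ((p *m p^T) 0 0 + (q *m q^T) 0 0) = 0.
  by rewrite mulrDr; move: E; lra.
move=> /eqP; rewrite mulf_eq0 => /orP[/eqP //|].
rewrite paddr_eq0 ?row_dot_self_ge0// => /andP[/eqP pp /eqP qq].
by move: pq0; rewrite (row_dot_self_eq0 pp) (row_dot_self_eq0 qq) eqxx.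
Qed.

Lemma char_poly_split_real (R : realType) (n : nat) (X : 'M[R]_n) :
  (forall z : R[i], eigenvalue (map_mx (real_complex R) X) z ->
     complex.Im z = 0) ->
  exists s : seq R, char_poly X = \prod_(x <- s) ('X - x%:P).
Proof.
move=> Im0; have [r rE] := closed_field_poly_normal
  (char_poly (map_mx (real_complex R) X)).
move: rE; rewrite (monicP (char_poly_monic _)) scale1r => rE.
exists [seq complex.Re z | z <- r].
apply: (map_poly_inj (real_complex R)).
rewrite map_char_poly rE rmorph_prod big_map /=.
rewrite big_seq [RHS]big_seq; apply: eq_bigr => z zr.
rewrite map_polyXsubC; congr ('X - _%:P).
have /Im0 : eigenvalue (map_mx (real_complex R) X) z.
  by rewrite eigenvalue_root_char rE root_prod_XsubC.
by case: z {zr} => x y /= ->.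
Qed.

(** If u is an eigenvector of exp X and X has real spectrum, Cayley-Hamilton
    gives u (X - x1) .. (X - xk) = 0. Each factor other than X - ln d is
    injective on the d-eigenspace of exp X, and X - ln d has no Jordan block
    there; cancelling the factors one by one leaves u (X - ln d) = 0. *)
Lemma eigenvector_log (R : realType) (n : nat) (X : 'M[R]_n.+1) (s : seq R)
    (d : R) (u : 'rV[R]_n.+1) :
  char_poly X = \prod_(x <- s) ('X - x%:P) -> 0 < d ->
  u *m expmx X = d *: u -> u *m X = ln d *: u.
Proof.
move=> Xs d0 uU; have ed : expR (ln d) = d by rewrite lnK.
have : u *m \prod_(x <- s) (X - x%:M) = 0.
  rewrite (_ : \prod_(x <- s) _ = horner_mx X (char_poly X)).
    by rewrite Cayley_Hamilton mulmx0.
  rewrite Xs rmorph_prod /=; apply: eq_bigr => x _.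
  by rewrite rmorphB /= horner_mx_X horner_mx_C.
move: u uU; elim: s {Xs} => [|x s IH] u uU.
  by rewrite big_nil mulmx1 => ->; rewrite mul0mx scaler0.
have stable y (v : 'rV[R]_n.+1) : v *m expmx X = d *: v ->
    v *m (X - y%:M) *m expmx X = d *: (v *m (X - y%:M)).
  move=> vU; rewrite !mulmxBr mulmxBl -mulmxA expmx_comm mulmxA vU.
  by rewrite !mul_mx_scalar -!scalemxAl vU scalerBr !scalerA mulrC.
rewrite big_cons -mulmxE mulmxA => /(IH _ (stable x u uU)) {IH}.
rewrite mulmxBr mul_mx_scalar => h.
pose v := u *m (X - (ln d)%:M).
have uX : u *m X = ln d *: u + v.
  by rewrite /v mulmxBr mul_mx_scalar addrC subrK.
have vX : v *m X = x *: v.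
  move: h; rewrite /v mulmxBr mul_mx_scalar !mulmxBl -!scalemxAl.
  move: (u *m X *m X) (u *m X) => A B h.
  by apply/rowP => j; move/rowP: h => /(_ j); rewrite !mxE; lra.
have vU : v *m expmx X = d *: v by exact: stable.
have vX0 : v *m X = x *: v + 0 by rewrite addr0.
have v0 : (expR x - d) *: v = 0.
  by rewrite scalerBl -vU (expmx_jordan2 vX0) ?mul0mx ?scaler0// addr0 subrr.
suff v00 : v = 0 by rewrite uX v00 addr0.
have [xd|xd] := eqVneq x (ln d).
  have := expmx_jordan2 uX; rewrite -xd => /(_ vX).
  rewrite uU xd ed => /(scalerI (lt0r_neq0 d0)) e.
  by apply: (addrI u); rewrite -e addr0.
move/eqP: v0; rewrite scaler_eq0 subr_eq0 => /orP[/eqP e|/eqP //].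
by move: xd; rewrite -e expRK eqxx.
Qed.

(** A real logarithm of a symmetric matrix in the strip |Im z| < pi has real
    spectrum: e^z is real there only for real z. *)
Lemma principal_log_real (R : realType) (n : nat) (U X : 'M[R]_n) :
  U^T = U -> principal_log U X ->
  forall z : R[i], eigenvalue (map_mx (real_complex R) X) z ->
    complex.Im z = 0.
Proof.
move=> Us [XU Xstrip] z zX; have := Xstrip z zX.
have [p [q [pq0 pX qX]]] := eigenvalue_complex_row zX.
have [] := expmx_eigenC pX qX; rewrite XU.
set a := complex.Re z; set b := complex.Im z => pU qU.
have /(sym_rotation_eq0 Us pq0) : p *m U =
    (expR a * cos b) *: p - (expR a * sin b) *: q.
  by rewrite pU scalerBr !scalerA.
have qU' : q *m U = (expR a * sin b) *: p + (expR a * cos b) *: q.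
  by rewrite qU scalerDr !scalerA.
move=> /(_ qU') /eqP; rewrite mulf_eq0 expR_eq0 /= => /eqP sb0.
rewrite ltr_norml => /andP[bl br].
have [b0|b0|//] := ltgtP b 0.
  have : 0 < sin (- b) by apply: sin_gt0_pi; apply/andP; split; lra.
  by rewrite sinN sb0 oppr0 ltxx.
have : 0 < sin b by apply: sin_gt0_pi; rewrite b0.
by rewrite sb0 ltxx.
Qed.

(** * Square roots and logarithms in an orthonormal eigenbasis *)

Lemma row_orthodiag (R : realType) (n : nat) (Q : 'M[R]_n) (d : 'rV[R]_n)
    (i : 'I_n) :
  Q *m Q^T = 1%:M ->
  row i Q *m (Q^T *m diag_mx d *m Q) = d 0 i *: row i Q.
Proof.
move=> QQ; rewrite !rowE -!mulmxA [Q *m (Q^T *m _)]mulmxA QQ mul1mx.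
by rewrite mulmxA -rowE row_diag_mx -scalemxAl.
Qed.

Lemma eq_orthodiag (R : realType) (n : nat) (Q : 'M[R]_n) (d : 'rV[R]_n)
    (M : 'M[R]_n) :
  Q *m Q^T = 1%:M -> (forall i, row i Q *m M = d 0 i *: row i Q) ->
  M = Q^T *m diag_mx d *m Q.
Proof.
move=> QQ rM; rewrite -[M]mul1mx -(mulmx1C QQ) -!mulmxA; congr (_ *m _).
apply/row_matrixP => i; rewrite row_mul rM rowE mulmxA -rowE row_diag_mx.
by rewrite -scalemxAl -rowE.
Qed.

Lemma tr_orthodiag (R : realType) (n : nat) (Q : 'M[R]_n) (d : 'rV[R]_n) :
  (Q^T *m diag_mx d *m Q)^T = Q^T *m diag_mx d *m Q.
Proof. by rewrite !trmx_mul trmxK tr_diag_mx mulmxA. Qed.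

Lemma sym_eigenvalue_real (R : realType) (n : nat) (X : 'M[R]_n) (z : R[i]) :
  X^T = X -> eigenvalue (map_mx (real_complex R) X) z -> complex.Im z = 0.
Proof.
move=> Xs /eigenvalue_complex_row [p [q [pq0 pX qX]]].
exact: sym_rotation_eq0 Xs pq0 pX qX.
Qed.

Lemma logmx_orthodiag (R : realType) (n : nat) (Q : 'M[R]_n.+1)
    (d : 'rV[R]_n.+1) :
  Q *m Q^T = 1%:M -> (forall i, 0 < d 0 i) ->
  logmx (Q^T *m diag_mx d *m Q) = Q^T *m diag_mx (map_mx (@ln R) d) *m Q.
Proof.
move=> QQ d0; set A := Q^T *m diag_mx d *m Q.
set Y := Q^T *m _ *m Q; apply: xget_unique => [|X XA].
  split.
    apply: eq_orthodiag => // i.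
    have rY : row i Q *m Y = ln (d 0 i) *: row i Q + 0.
      by rewrite addr0 row_orthodiag// mxE.
    rewrite (expmx_jordan2 rY) ?mul0mx ?scaler0//.
    by rewrite addr0 lnK// posrE.
  move=> z /(sym_eigenvalue_real (tr_orthodiag _ _)) ->.
  by rewrite normr0 pi_gt0.
have As : A^T = A by exact: tr_orthodiag.
have [s Xs] := char_poly_split_real (principal_log_real As XA).
apply: eq_orthodiag => // i; rewrite mxE.
apply: (eigenvector_log Xs) => //.
by case: XA => -> _; rewrite row_orthodiag.
Qed.

Lemma posdef_orthodiag (R : realType) (n : nat) (Q : 'M[R]_n) (d : 'rV[R]_n) :
  Q *m Q^T = 1%:M -> (forall i, 0 < d 0 i) -> posdefmx (Q^T *m diag_mx d *m Q).
Proof.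
move=> QQ d0; split; first exact: tr_orthodiag.
move=> x x0; pose y := Q *m x.
have y0 : y != 0.
  apply: contraNneq x0 => y0; rewrite -[x]mul1mx -(mulmx1C QQ) -mulmxA.
  by rewrite -/y y0 mulmx0.
have -> : x^T *m (Q^T *m diag_mx d *m Q) *m x = y^T *m diag_mx d *m y.
  by rewrite /y trmx_mul !mulmxA.
have -> : \tr (y^T *m diag_mx d *m y) = \sum_i d 0 i * y i 0 ^+ 2.
  rewrite /mxtrace big_ord1 mxE; apply: eq_bigr => i _.
  by rewrite mul_mx_diag !mxE; ring.
have yd i : 0 <= d 0 i * y i 0 ^+ 2 by rewrite mulr_ge0 ?sqr_ge0// ltW.
rewrite lt_neqAle sumr_ge0// andbT eq_sym psumr_eq0//.
apply: contraNN y0 => /allP y0; apply/eqP/colP => i; rewrite [RHS]mxE.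
have := y0 i (mem_index_enum _).
by rewrite mulf_eq0 sqrf_eq0 gt_eqF//= => /eqP.
Qed.

(** If U is positive definite and U^2 x = d x, then y := U x - sqrt d x satisfies
    U y = - sqrt d y, which positivity allows only for y = 0. *)
Lemma sqrtmx_orthodiag (R : realType) (n : nat) (Q : 'M[R]_n) (d : 'rV[R]_n) :
  Q *m Q^T = 1%:M -> (forall i, 0 < d 0 i) ->
  sqrtmx (Q^T *m diag_mx d *m Q) = Q^T *m diag_mx (map_mx Num.sqrt d) *m Q.
Proof.
move=> QQ d0; apply: xget_unique => [|U [[Us Up] UU]].
  split; first by apply: posdef_orthodiag => // i; rewrite mxE sqrtr_gt0.
  apply: eq_orthodiag => // i; rewrite mulmxA row_orthodiag//.
  rewrite -scalemxAl row_orthodiag// scalerA mxE -expr2 sqr_sqrtr//.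
  exact: ltW.
apply: eq_orthodiag => // i; rewrite mxE.
set u := row i Q; set r := Num.sqrt (d 0 i).
have rr : r * r = d 0 i by rewrite -expr2 sqr_sqrtr// ltW.
pose y := u *m U - r *: u.
have yU : y *m U = - r *: y.
  rewrite /y mulmxBl -mulmxA UU row_orthodiag// -rr -scalemxAl.
  by rewrite scalerBr !scaleNr opprK scalerA addrC.
apply/eqP; rewrite -subr_eq0 -/y; apply/negP => /negP y0.
have yT0 : y^T != 0.
  by apply: contraNneq y0 => y0; rewrite -[y]trmxK y0 trmx0.
have := Up _ yT0; rewrite trmxK yU -scalemxAl mxtraceZ /mxtrace big_ord1.
rewrite mulNr oppr_gt0 ltNge mulr_ge0 ?sqrtr_ge0//.
exact: row_dot_self_ge0.
Qed.

Lemma frobenius2_orthodiag (R : realType) (n : nat) (Q : 'M[R]_n)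
    (d : 'rV[R]_n) :
  Q *m Q^T = 1%:M ->
  frobenius2 (Q^T *m diag_mx d *m Q) = \sum_i d 0 i ^+ 2.
Proof.
move=> QQ; rewrite /frobenius2 tr_orthodiag mulmxA mxtrace_mulC !mulmxA QQ mul1mx.
rewrite -(mulmxA (diag_mx d)) QQ mulmx1 mulmx_diag mxtrace_diag.
by apply: eq_bigr => i _; rewrite mxE expr2.
Qed.

Lemma frobenius2_log_sqrt (R : realType) (n : nat) (Q : 'M[R]_n.+1)
    (d : 'rV[R]_n.+1) :
  Q *m Q^T = 1%:M -> (forall i, 0 < d 0 i) ->
  frobenius2 (logmx (sqrtmx (Q^T *m diag_mx d *m Q))) =
  (\sum_i ln (d 0 i) ^+ 2) / 4.
Proof.
move=> QQ d0; rewrite sqrtmx_orthodiag// logmx_orthodiag//; last first.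
  by move=> i; rewrite mxE sqrtr_gt0.
rewrite frobenius2_orthodiag// mulr_suml; apply: eq_bigr => i _; rewrite !mxE.
have r0 : 0 < Num.sqrt (d 0 i) by rewrite sqrtr_gt0.
have -> : ln (d 0 i) = ln (Num.sqrt (d 0 i)) *+ 2.
  by rewrite -lnXn// sqr_sqrtr// ltW.
by rewrite -mulr_natr; field.
Qed.

(** * The spectral theorem and the two stretch tensors *)

(** The reflection exchanging the first basis vector and a unit vector u. *)
Lemma householder (R : realType) (n : nat) (u : 'rV[R]_n.+1) :
  u *m u^T = 1%:M ->
  exists H : 'M[R]_n.+1, [/\ H^T = H, H *m H = 1%:M & delta_mx 0 0 *m H = u].
Proof.
move=> uu; pose e : 'rV[R]_n.+1 := delta_mx 0 0; pose w := e - u.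
have [w0|w0] := eqVneq w 0.
  exists 1%:M; rewrite trmx1 mulmx1; split=> //; rewrite mulmx1.
  by apply/eqP; rewrite -subr_eq0 -/e -/w w0.
have ee : e *m e^T = 1%:M.
  by rewrite trmx_delta mul_delta_mx; apply/matrixP => i j; rewrite !mxE !ord1.
pose t : R := (e *m u^T) 0 0.
have eu : e *m u^T = t%:M by exact: mx11_scalar.
have ue : u *m e^T = t%:M by rewrite -[u *m _]trmxK trmx_mul trmxK eu tr_scalar_mx.
pose c := 2 * (1 - t).
have wwT : w *m w^T = c%:M.
  rewrite /w linearB /= mulmxBl !mulmxBr ee uu eu ue /c.
  by apply/matrixP => i j; rewrite !mxE !ord1 /=; ring.
have c0 : c != 0.
  apply: contraNneq w0 => c0; apply/eqP; apply: row_dot_self_eq0.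
  by rewrite wwT c0 mxE mul0rn.
have WW : (w^T *m w) *m (w^T *m w) = c *: (w^T *m w).
  by rewrite mulmxA -(mulmxA w^T) wwT mul_mx_scalar -scalemxAl.
exists (1%:M - (2 / c) *: (w^T *m w)); split.
- by rewrite linearB /= trmx1 linearZ /= trmx_mul trmxK.
- move: (w^T *m w) WW => W WW.
  rewrite mulmxBl mul1mx mulmxBr mulmx1 -scalemxAl -scalemxAr WW !scalerA.
  by apply/matrixP => i j; rewrite !mxE; field.
- rewrite mulmxBr mulmx1 -scalemxAr mulmxA.
  have -> : e *m w^T = (1 - t)%:M.
    by rewrite /w linearB /= mulmxBr ee eu raddfB.
  rewrite mul_scalar_mx scalerA.
  have -> : 2 / c * (1 - t) = 1.
    have t0 : 1 - t != 0 by apply: contraNneq c0 => t0; rewrite /c t0 mulr0.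
    by rewrite /c; field.
  by rewrite scale1r /w opprB addrC subrK.
Qed.

Lemma sym_real_eigenvector (R : realType) (n : nat) (A : 'M[R]_n.+1) :
  A^T = A -> exists a (u : 'rV[R]_n.+1), u *m u^T = 1%:M /\ u *m A = a *: u.
Proof.
move=> As.
have [z zA] := eigenvalue_closed (map_mx (real_complex R) A) (ltn0Sn n).
have z0 := sym_eigenvalue_real As zA.
have [p [q []]] := eigenvalue_complex_row zA.
rewrite z0 !scale0r subr0 add0r => pq pA qA.
have [v v0 vA] : exists2 v : 'rV[R]_n.+1, v != 0 & v *m A = complex.Re z *: v.
  by case/orP: pq; [exists p|exists q].
pose s := (v *m v^T) 0 0.
have s0 : 0 < s.
  rewrite lt_neqAle row_dot_self_ge0 andbT eq_sym.
  by apply: contraNneq v0 => /row_dot_self_eq0 ->.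
exists (complex.Re z), ((Num.sqrt s)^-1 *: v); split; last first.
  by rewrite -scalemxAl vA !scalerA mulrC.
rewrite linearZ /= -scalemxAl -scalemxAr scalerA [v *m _]mx11_scalar -/s.
rewrite scale_scalar_mx -invfM -expr2 sqr_sqrtr ?ltW// mulVf//.
exact: lt0r_neq0.
Qed.

(** Spectral theorem for real symmetric matrices: reflect a unit eigenvector
    onto the first axis and recurse on the remaining block. *)
Theorem sym_orthodiagonalizable (R : realType) (n : nat) (A : 'M[R]_n) :
  A^T = A ->
  exists (Q : 'M[R]_n) (d : 'rV[R]_n),
    Q *m Q^T = 1%:M /\ A = Q^T *m diag_mx d *m Q.
Proof.
elim: n A => [|n IH] A As.
  by exists 1%:M, 0; split; apply/matrixP => -[].
have [a [u [uu uA]]] := sym_real_eigenvector As.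
have [H [Hs HH eH]] := householder uu.
pose B : 'M[R]_(1 + n) := H *m A *m H.
have Bs : B^T = B by rewrite /B !trmx_mul Hs As mulmxA.
have eB : (delta_mx 0 0 : 'rV_(1 + n)) *m B = a *: delta_mx 0 0.
  rewrite /B !mulmxA eH uA -scalemxAl -eH -mulmxA HH mulmx1 //.
have Bul : ulsubmx B = a%:M.
  apply/matrixP => i j; rewrite !ord1 !mxE.
  move/rowP: eB => /(_ (lshift n 0)); rewrite -rowE !mxE /=.
  by rewrite (_ : lshift n 0 = 0) ?eqxx ?mulr1//; apply/val_inj.
have Bur : ursubmx B = 0.
  apply/matrixP => i j; rewrite !ord1 !mxE.
  move/rowP: eB => /(_ (rshift 1 j)); rewrite -rowE !mxE /= mulr0.
  by rewrite (_ : lshift n 0 = 0)//; apply/val_inj.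
have Bdl : dlsubmx B = 0 by rewrite -[dlsubmx B]trmxK trmx_dlsub Bs Bur trmx0.
have [|Q [d [QQ Bd]]] := IH (drsubmx B); first by rewrite trmx_drsub Bs.
have BE : B = block_mx a%:M 0 0 (Q^T *m diag_mx d *m Q).
  by rewrite -[LHS]submxK Bul Bur Bdl Bd.
pose P : 'M[R]_(1 + n) := block_mx 1%:M 0 0 Q.
have PP : P *m P^T = 1%:M.
  rewrite /P tr_block_mx !trmx0 trmx1 mulmx_block QQ.
  by rewrite !mulmx0 !mul0mx !addr0 !add0r mul1mx -scalar_mx_block.
exists (P *m H), (row_mx a%:M d : 'rV_(1 + n)); split.
  by rewrite trmx_mul Hs mulmxA -(mulmxA P) HH mulmx1.
have -> : diag_mx (row_mx a%:M d : 'rV_(1 + n)) = block_mx a%:M 0 0 (diag_mx d).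
  rewrite diag_mx_row; congr block_mx.
  by apply/matrixP => i j; rewrite !ord1 !mxE.
have PBP : P^T *m block_mx a%:M 0 0 (diag_mx d) *m P = B.
  rewrite BE /P tr_block_mx !trmx0 trmx1 !mulmx_block.
  by rewrite !(mulmx0, mul0mx, addr0, add0r, mul1mx, mulmx1).
rewrite trmx_mul Hs -!mulmxA [P^T *m _]mulmxA [_ *m (P *m H)]mulmxA PBP.
by rewrite /B -!mulmxA HH mulmx1 mulmxA HH mul1mx.
Qed.

(** The eigenvalues are positive because d_i is the squared norm of F applied to
    the i-th row of Q. *)
Lemma gram_orthodiag (R : realType) (n : nat) (F : 'M[R]_n) :
  F \in unitmx ->
  exists (Q : 'M[R]_n) (d : 'rV[R]_n), [/\ Q *m Q^T = 1%:M,
    F^T *m F = Q^T *m diag_mx d *m Q & forall i, 0 < d 0 i].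
Proof.
move=> Fu; have [|Q [d [QQ Fd]]] := @sym_orthodiagonalizable R n (F^T *m F).
  by rewrite trmx_mul trmxK.
exists Q, d; split=> // i.
pose v := row i Q *m F^T.
have dE : (v *m v^T) 0 0 = d 0 i.
  rewrite /v trmx_mul trmxK mulmxA -(mulmxA (row i Q)) Fd row_orthodiag//.
  rewrite -scalemxAl mxE.
  suff -> : (row i Q *m (row i Q)^T) 0 0 = 1 by rewrite mulr1.
  have := congr1 (fun M : 'M[R]_n => M i i) QQ.
  rewrite !mxE eqxx => QQi; rewrite -[RHS]QQi.
  by apply: eq_bigr => j _; rewrite !mxE.
rewrite -dE lt_neqAle row_dot_self_ge0 andbT eq_sym.
apply/eqP => /row_dot_self_eq0 v0.
have : row i Q = 0.
  by rewrite -[row i Q](mulmxK (_ : F^T \in unitmx)) ?unitmx_tr// -/v v0 mul0mx.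
move=> r0; have := congr1 (fun M : 'M[R]_n => row i M) QQ.
rewrite /= row_mul r0 mul0mx => /rowP /(_ i); rewrite !mxE eqxx => /eqP.
by rewrite eq_sym oner_eq0.
Qed.

(** With F^T F = Q^T diag(d) Q, the matrix P = diag(d)^(-1/2) Q F^T is orthogonal
    and diagonalizes F F^T with the same d. *)
Lemma frobenius2_log_stretch (R : realType) (n : nat) (F : 'M[R]_n.+1) :
  F \in unitmx ->
  frobenius2 (logmx (stretchU F)) = frobenius2 (logmx (stretchV F)).
Proof.
move=> Fu; have [Q [d [QQ Fd d0]]] := gram_orthodiag Fu.
rewrite /stretchU /stretchV Fd frobenius2_log_sqrt//.
pose D : 'M[R]_n.+1 := diag_mx (map_mx (fun x => (Num.sqrt x)^-1) d).
pose P := D *m Q *m F^T.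
have DdD : D *m diag_mx d *m D = 1%:M.
  rewrite !mulmx_diag; apply/matrixP => i j; rewrite !mxE.
  case: eqP => // _; rewrite !mulr1n mulrAC -invfM -expr2 sqr_sqrtr ?ltW//.
  by rewrite mulVf// gt_eqF.
have PP : P *m P^T = 1%:M.
  have -> : P *m P^T = D *m (Q *m (F^T *m F) *m Q^T) *m D.
    by rewrite /P !trmx_mul trmxK tr_diag_mx !mulmxA.
  by rewrite Fd !mulmxA -(mulmxA D) QQ mulmx1 -(mulmxA _ Q) QQ mulmx1 DdD.
have -> : F *m F^T = P^T *m diag_mx d *m P.
  have -> : P^T *m diag_mx d *m P = F *m Q^T *m (D *m diag_mx d *m D) *m Q *m F^T.
    by rewrite /P !trmx_mul trmxK tr_diag_mx !mulmxA.
  by rewrite DdD mulmx1 -(mulmxA F) (mulmx1C QQ) mulmx1.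
by rewrite frobenius2_log_sqrt.
Qed.

(** * Energy along a rank-one line *)

(** A planar deformation extended by the identity: the additional eigenvalues 1
    of the Gram matrix have logarithm 0. *)
Lemma frobenius2_log_plane (R : realType) (k : nat) (G : 'M[R]_(1 + 1)) :
  G \in unitmx ->
  exists d1 d2 : R, [/\ 0 < d1, 0 < d2, d1 + d2 = \tr (G^T *m G),
    d1 * d2 = \det G ^+ 2 &
    frobenius2 (logmx (stretchU (block_mx G 0 0 1%:M : 'M[R]_(1 + 1 + k)))) =
      (ln d1 ^+ 2 + ln d2 ^+ 2) / 4].
Proof.
move=> G0; have [Q [d [QQ Gd d0]]] := gram_orthodiag G0.
exists (d 0 0), (d 0 1).
have sum2 (f : R -> R) : \sum_i f (d 0 i) = f (d 0 0) + f (d 0 1).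
  rewrite big_ord_recl big_ord1; congr (_ + f (d 0 _)); exact/val_inj.
split=> //.
- rewrite Gd mxtrace_mulC mulmxA QQ mul1mx mxtrace_diag; exact/esym/(sum2 id).
- have -> : \det G ^+ 2 = \det (G^T *m G) by rewrite det_mulmx det_tr expr2.
  rewrite Gd !det_mulmx det_diag mulrAC -det_mulmx (mulmx1C QQ) det1 mul1r.
  rewrite big_ord_recl big_ord1; congr (_ * d 0 _); exact/val_inj.
pose P : 'M[R]_(1 + 1 + k) := block_mx Q 0 0 1%:M.
pose e : 'rV[R]_(1 + 1 + k) := row_mx d (const_mx 1).
have PP : P *m P^T = 1%:M.
  rewrite /P tr_block_mx !trmx0 trmx1 mulmx_block QQ.
  by rewrite !mulmx0 !mul0mx !addr0 !add0r mul1mx -scalar_mx_block.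
have e0 i : 0 < e 0 i.
  by rewrite -(splitK i); case: (fintype.split i) => j; rewrite /=
    ?row_mxEl ?row_mxEr ?mxE.
have PE : (block_mx G 0 0 1%:M : 'M[R]_(1 + 1 + k))^T *m block_mx G 0 0 1%:M =
    P^T *m diag_mx e *m P.
  rewrite /e /P diag_mx_row diag_const_mx !tr_block_mx !trmx0 trmx1 !mulmx_block.
  by rewrite !(mulmx0, mul0mx, addr0, add0r, mul1mx, mulmx1) Gd.
rewrite /stretchU PE (@frobenius2_log_sqrt R (1 + k)%N P e)//; congr (_ / 4).
rewrite -[LHS]/(\sum_(i < 1 + 1 + k) ln (e 0 i) ^+ 2).
rewrite big_split_ord /= -(sum2 (fun x => ln x ^+ 2)) [X in _ + X]big1 => [|i _].
  by rewrite addr0; apply: eq_bigr => i _; rewrite row_mxEl.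
by rewrite row_mxEr mxE ln1 expr0n.
Qed.

Definition plane_line (R : realType) (l c t : R) : 'M[R]_(1 + 1) :=
  block_mx (l * (1 + t))%:M (l * (c * t))%:M 0 l%:M.

Lemma det_plane_line (R : realType) (l c t : R) :
  \det (plane_line l c t) = l ^+ 2 * (1 + t).
Proof. by rewrite /plane_line det_ublock !det_scalar1; ring. Qed.

Lemma tr_plane_line (R : realType) (l c t : R) :
  \tr ((plane_line l c t)^T *m plane_line l c t) =
  l ^+ 2 * ((1 + t) ^+ 2 + c ^+ 2 * t ^+ 2 + 1).
Proof.
rewrite /plane_line tr_block_mx mulmx_block mxtrace_block !tr_scalar_mx trmx0.
by rewrite mul0mx addr0 -!scalar_mxM mxtraceD !mxtrace_scalar; ring.
Qed.

Definition space_line (R : realType) (k : nat) (l c t : R) : 'M[R]_(1 + 1 + k) :=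
  block_mx (plane_line l c t) 0 0 1%:M.

Lemma det_space_line (R : realType) (k : nat) (l c t : R) :
  \det (space_line k l c t) = l ^+ 2 * (1 + t).
Proof. by rewrite /space_line det_ublock det1 mulr1 det_plane_line. Qed.

Lemma tensorE (R : realType) (n : nat) (xi eta : 'cV[R]_n) :
  tensor xi eta = xi *m eta^T.
Proof. by apply/matrixP => i j; rewrite !mxE big_ord1 !mxE. Qed.

Lemma space_lineE (R : realType) (k : nat) (l c : R) :
  exists xi eta : 'cV[R]_(1 + 1 + k),
    forall t, space_line k l c 0 + t *: tensor xi eta = space_line k l c t.
Proof.
exists (col_mx (col_mx 1%:M 0) 0), (col_mx (col_mx l%:M (l * c)%:M) 0) => t.
rewrite tensorE /space_line /plane_line !tr_col_mx !tr_scalar_mx !trmx0.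
rewrite !mul_col_row !mul0mx !mulmx0 !mul1mx.
rewrite !scale_block_mx !scaler0 !add_block_mx !addr0.
by congr (block_mx (block_mx _ _ _ _) _ _ _);
  apply/matrixP => i j; rewrite !ord1 !mxE /=; ring.
Qed.

(** Of the convexity along the line only this consequence is insensitive to an
    increasing change of values, so that it can be read off from the energy. *)
Lemma rank_one_convex_le_max (R : realType) (k : nat) (l c : R)
    (W : 'M[R]_(1 + 1 + k) -> R) (a m b : R) :
  rank_one_convex W -> 0 < l -> -1 < a -> a < m -> m < b ->
  W (space_line k l c m) <=
    Num.max (W (space_line k l c a)) (W (space_line k l c b)).
Proof.
move=> Wc l0 a1 am mb; have [xi [eta lineE]] := space_lineE k l c.
have F0 : GLpos (space_line k l c 0).
  by rewrite /GLpos /= det_space_line addr0 mulr1 exprn_gt0.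
have ab : 0 < b - a by lra.
pose I : set R := [set` `[a, b]%R].
have I0 t : I t -> 0 < \det (space_line k l c 0 + t *: tensor xi eta).
  rewrite /I /= in_itv /= => /andP[a_t _].
  by rewrite lineE det_space_line mulr_gt0 ?exprn_gt0//; lra.
have := Wc _ xi eta I F0 (@interval_is_interval _ _) I0.
pose p : R := (b - m) / (b - a).
have p0 : 0 <= p by rewrite divr_ge0; lra.
have p1 : p <= 1 by rewrite ler_pdivrMr// mul1r; lra.
move=> /(_ (Itv01 p0 p1) a b).
have aI : (a : R^o) \in (I : set R^o) by rewrite inE /I /= in_itv /= lexx; lra.
have bI : (b : R^o) \in (I : set R^o) by rewrite inE /I /= in_itv /= lexx; lra.
move=> /(_ aI bI).
rewrite !lineE => h.
have {h} : W (space_line k l c (p * a + (1 - p) * b)) <=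
    p * W (space_line k l c a) + (1 - p) * W (space_line k l c b) by exact: h.
have -> : p * a + (1 - p) * b = m by rewrite /p; field; lra.
move=> /le_trans; apply.
set M := Num.max _ _; rewrite (_ : M = p * M + (1 - p) * M); last by ring.
by rewrite lerD// ler_wpM2l ?subr_ge0// le_max lexx ?orbT.
Qed.

(** The energy h along the test line, up to the outer function Psi, together with
    the quasiconvexity that rank-one convexity of Psi o h forces. Only the trace
    and the determinant of the planar Gram matrix enter h. *)
Lemma line_energy (R : realType) (k : nat) (Psi : R -> R) (l c : R) :
  0 < l ->
  rank_one_convex (fun F : 'M[R]_(1 + 1 + k) =>
    Psi (frobenius2 (logmx (stretchU F)))) ->
  exists h : R -> R,
    (forall t, -1 < t -> exists d1 d2 : R, [/\ 0 < d1, 0 < d2,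
       d1 + d2 = l ^+ 2 * ((1 + t) ^+ 2 + c ^+ 2 * t ^+ 2 + 1),
       d1 * d2 = (l ^+ 2 * (1 + t)) ^+ 2 &
       h t = (ln d1 ^+ 2 + ln d2 ^+ 2) / 4]) /\
    (forall a m b, -1 < a -> a < m -> m < b ->
       Psi (h m) <= Num.max (Psi (h a)) (Psi (h b))).
Proof.
move=> l0 Wc.
exists (fun t => frobenius2 (logmx (stretchU (space_line k l c t)))).
split=> [t t1|a m b]; last exact: rank_one_convex_le_max Wc l0.
have [|d1 [d2 [h1 h2 h3 h4 h5]]] :=
    @frobenius2_log_plane R k (plane_line l c t).
  rewrite unitmxE unitfE det_plane_line mulf_neq0 ?expf_neq0 ?gt_eqF//; lra.
by exists d1, d2; rewrite -tr_plane_line -(det_plane_line l c).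
Qed.

Lemma pair_of_sum_prod (R : realFieldType) (x y a b : R) :
  x + y = a + b -> x * y = a * b -> (x = a /\ y = b) \/ (x = b /\ y = a).
Proof.
move=> s p; have : (x - a) * (x - b) = 0.
  have yE : y = a + b - x by lra.
  have -> : (x - a) * (x - b) = a * b - x * (a + b - x) by ring.
  by rewrite -yE p subrr.
move=> /eqP; rewrite mulf_eq0 !subr_eq0 => /orP[] /eqP xE; [left|right];
  split=> //; lra.
Qed.

(** Along t |-> diag (1 + t, 1, .., 1) the energy has its strict minimum at the
    identity, which a decreasing Psi turns into a strict maximum. *)
Lemma decreasing_not_rank_one_convex (R : realType) (k : nat) (Psi : R -> R) :
  {in `[0, +oo[ &, {homo Psi : x y /~ x < y}} ->
  ~ rank_one_convex (fun F : 'M[R]_(1 + 1 + k) =>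
      Psi (frobenius2 (logmx (stretchU F)))).
Proof.
move=> Pd /(line_energy 0 ltr01) [h [hE hle]].
have hP (t : R) : -1 < t -> t != 0 -> 0 < h t.
  move=> t1 t0; have [d1 [d2 [d10 d20 _ p ->]]] := hE t t1.
  rewrite divr_gt0// lt_neqAle addr_ge0 ?sqr_ge0// andbT eq_sym.
  rewrite paddr_eq0 ?sqr_ge0// !sqrf_eq0; apply/negP => /andP[/eqP l1 /eqP l2].
  move: p; rewrite -[d1]lnK ?posrE// -[d2]lnK ?posrE// l1 l2 expR0 mulr1 => p.
  have : t * (t + 2) = 0.
    transitivity ((1 ^+ 2 * (1 + t)) ^+ 2 - 1); first by ring.
    by rewrite -p subrr.
  by move=> /eqP; rewrite mulf_eq0 (negbTE t0) => /eqP; lra.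
have h0 : h 0 = 0.
  have [|d1 [d2 [_ _ s p ->]]] := hE 0; first by lra.
  have [||[-> ->]|[-> ->]] := @pair_of_sum_prod R d1 d2 1 1.
  - by rewrite s; ring.
  - by rewrite p; ring.
  - by rewrite ln1; ring.
  - by rewrite ln1; ring.
have : Psi (h 0) <= Num.max (Psi (h (- 2^-1))) (Psi (h 2^-1)) by apply: hle; lra.
have hN : 0 < h (- 2^-1) by apply: hP; lra.
have hR : 0 < h 2^-1 by apply: hP; lra.
by rewrite h0 leNgt gt_max !Pd ?in_itv ?andbT//=; exact: ltW.
Qed.

(** * An energy with an interior maximum along a rank-one line *)

Lemma ln_expV2 (R : realType) (k : nat) :
  ln ((2^-1 : R) ^+ k) = - (ln 2 *+ k).
Proof. by rewrite lnXn ?invr_gt0// lnV ?posrE// mulNrn. Qed.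

(** An interior value exceeds both end values: the energy is 578 (ln 2)^2 at t = 0,
    584 (ln 2)^2 at t = 3, and at most 578 (ln 2)^2 at t = 15. *)
Lemma increasing_not_rank_one_convex (R : realType) (k : nat) (Psi : R -> R) :
  {in `[0, +oo[ &, {homo Psi : x y / x < y}} ->
  ~ rank_one_convex (fun F : 'M[R]_(1 + 1 + k) =>
      Psi (frobenius2 (logmx (stretchU F)))).
Proof.
move=> Pi Wc; pose r : R := 2^-1.
have r0 : 0 < r by rewrite invr_gt0.
have r1 : r <= 1 by rewrite /r; lra.
have r2 j : 2 ^+ j * r ^+ j = 1 by rewrite -exprMn mulfV ?expr1n.
pose L : R := ln 2; have L0 : 0 < L by rewrite ln_gt0// ltr1n.
have lnr j : ln (r ^+ j) = - (j%:R * L) by rewrite mulr_natl; exact: ln_expV2.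
clearbody r L.
have r10 : 0 < r ^+ 10 by rewrite exprn_gt0.
have r10' : r ^+ 10 <= 1 by rewrite exprn_ile1// ltW.
have c14 : 32 <= 2 ^+ 14 :> R.
  have -> : 2 ^+ 14 = 2 ^+ 5 * 2 ^+ 9 :> R by rewrite -exprD.
  have -> : 2 ^+ 5 = 32 :> R by ring.
  by rewrite ler_peMr// exprn_ege1// ler1n.
(* c2 solves 17 + 9 c2 = 4 (2^12 + 2^-12); the left side is the trace of the
   planar Gram matrix at t = 3 divided by l^2, and its determinant divided by l^4
   is 4^2, so that the singular values there have ratio 2^12 *)
pose c2 := (2 ^+ 14 + r ^+ 10 - 17) / 9.
pose c := Num.sqrt c2; pose l := r ^+ 17.
have cE : c ^+ 2 = c2 by rewrite sqr_sqrtr// /c2 divr_ge0//; lra.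
have l0 : 0 < l by rewrite exprn_gt0.
have l34 : l ^+ 2 = r ^+ 34 by rewrite -exprM.
clearbody l c.
have [h [hE hle]] := line_energy c l0 Wc.
have h0 : h 0 = 578 * L ^+ 2.
  have [|d1 [d2 [d10 d20 s p ->]]] := hE 0; first by lra.
  have [||[-> ->]|[-> ->]] := @pair_of_sum_prod R d1 d2 (r ^+ 34) (r ^+ 34).
  - by rewrite s l34; ring.
  - by rewrite p l34; ring.
  - by rewrite lnr; field.
  - by rewrite lnr; field.
have h1 : h 3 = 584 * L ^+ 2.
  have [|d1 [d2 [d10 d20 s p ->]]] := hE 3; first by lra.
  have [||[-> ->]|[-> ->]] := @pair_of_sum_prod R d1 d2 (r ^+ 20) (r ^+ 44).
  - rewrite s l34 cE /c2; transitivity (r ^+ 20 * (2 ^+ 14 * r ^+ 14) + r ^+ 44).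
      by field.
    by rewrite r2 mulr1.
  - rewrite p l34; transitivity (r ^+ 20 * r ^+ 44 * (2 ^+ 4 * r ^+ 4)).
      by ring.
    by rewrite r2 mulr1.
  - by rewrite !lnr; field.
  - by rewrite !lnr; field.
have h2 : h 15 <= 578 * L ^+ 2.
  have [|d1 [d2 [d10 d20 s p ->]]] := hE 15; first by lra.
  have {p} : ln d1 + ln d2 = - (60 * L).
    rewrite -lnM ?posrE// -lnr p l34; congr ln.
    transitivity (r ^+ 60 * (2 ^+ 8 * r ^+ 8)); first by ring.
    by rewrite r2 mulr1.
  have {}s : d1 + d2 <= r ^+ 14.
    have -> : r ^+ 14 = r ^+ 34 * (2 ^+ 6 * 2 ^+ 14).
      transitivity (r ^+ 14 * (2 ^+ 20 * r ^+ 20)); first by rewrite r2 mulr1.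
      by ring.
    rewrite s l34 ler_wpM2l ?exprn_ge0 ?ltW// cE /c2.
    have -> : 2 ^+ 6 = 64 :> R by ring.
    by move: c14 r10'; move: (2 ^+ 14) (r ^+ 10) => x y; lra.
  have ln_le d : 0 < d -> d <= r ^+ 14 -> ln d <= - (14 * L).
    by move=> d0 dr; rewrite -lnr ler_ln ?posrE ?exprn_gt0.
  have := ln_le d1 d10; have := ln_le d2 d20.
  move=> /(_ ltac:(lra)) x2 /(_ ltac:(lra)) x1 x12.
  (* the sum -60 L and the bound -14 L on both terms leave the product at least
     14 * 46 * L^2 *)
  nra.
have : Psi (h 3) <= Num.max (Psi (h 0)) (Psi (h 15)) by apply: hle; lra.
have L2 : 0 < L ^+ 2 by rewrite exprn_gt0.
have h15 : 0 <= h 15.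
  have [|d1 [d2 [_ _ _ _ ->]]] := hE 15; first by lra.
  by rewrite divr_ge0// addr_ge0 ?sqr_ge0.
rewrite leNgt gt_max !Pi ?in_itv ?andbT//=; lra.
Qed.

Theorem proposition4p1 (R : realType) (n : nat) (hn : (2 <= n)%N) :
  (forall F : 'M[R]_n, GLpos F ->
     frobenius2 (logmx (stretchU F)) = frobenius2 (logmx (stretchV F))) /\
  ~ exists Psi : R -> R,
      strictly_monotone_nneg Psi /\
      rank_one_convex (fun F : 'M[R]_n => Psi (frobenius2 (logmx (stretchU F)))).
Proof.
case: n hn => [|[|k]]// _; split=> [F|[Psi [[Pi|Pd] Wc]]].
- by move=> F0; apply: frobenius2_log_stretch; rewrite unitmxE unitfE gt_eqF.
- exact: (@increasing_not_rank_one_convex R k Psi).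
- exact: (@decreasing_not_rank_one_convex R k Psi).
Qed.
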